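(* Let $P\subseteq\mathbb{R}$ with the usual total order and let $K$ be a field. Let $f:M\to N$ be an epimorphism between persistence modules $M,N:P\to\mathbf{Vect}_K$ with direct-sum decompositions into finitely many interval modules. Then there are internal direct sum decompositions $M=\bigoplus_{a\in A}M_a$ and $N=\bigoplus_{a\in A}N_a$, where each $M_a$ is an interval module and each $N_a$ is either an interval module or zero, such that the following hold. Let $i_a:M_a\to M$ and $p'_a:N\to N_a$ denote the canonical maps. For all $a\in A$, if $N_a$ is nonzero then: - $M_a$ and $N_a$ have the same left end; - $p'_afi_a:M_a\to N_a$ is an epimorphism; - for all other interval modules $M_b$ ($b\ne a$) with the same left end as $N_a$, $p'_afi_b=0$; - for all other interval modules $N_b$ ($b\ne a$) with the same left end as $M_a$, $p'_bfi_a=0$.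
   Context: $P$ is viewed as a category via $\le$; a persistence module is a functor $P\to\mathbf{Vect}_K$, and morphisms are natural transformations. An interval in $P$ is a nonempty convex subset. The interval module of an interval $I$ has value $K$ at points of $I$, $0$ elsewhere, and identity maps between points of $I$; a summand isomorphic to such a module is also called an interval module, and is referred to by its interval. Two intervals $I$ and $J$ (or the corresponding interval modules) have the same left end if $\inf I=\inf J$ and ($\inf I\in I$ if and only if $\inf J\in J$). *)

(* Defs.v *)
From HB Require Import structures.
From mathcomp Require Import all_boot all_order all_algebra.
From mathcomp Require Import all_classical all_reals ereal.

Set Implicit Arguments.
Unset Strict Implicit.
Unset Printing Implicit Defensive.

Import Order.TTheory GRing.Theory Num.Theory.

Local Open Scope classical_set_scope.
Local Open Scope ring_scope.

(* The poset is a subset P of the reals; its points are the elements of the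
   coerced type {x : R | x \in P}, compared through \val. *)

Record persmod (R : realType) (P : set R) (K : fieldType) := PersMod {
  pm_obj :> P -> lmodType K;
  pm_map : forall s t : P, \val s <= \val t -> {linear pm_obj s -> pm_obj t};
  pm_id : forall (s : P) (h : \val s <= \val s) (x : pm_obj s),
    pm_map h x = x;
  pm_comp : forall (s t u : P) (hst : \val s <= \val t)
    (htu : \val t <= \val u) (hsu : \val s <= \val u) (x : pm_obj s),
    pm_map hsu x = pm_map htu (pm_map hst x) }.

Arguments pm_map {R P K p s t} h.

Record pmhom (R : realType) (P : set R) (K : fieldType) (M N : persmod P K) :=
  PMHom {
    hom_fun :> forall s : P, {linear M s -> N s};
    hom_natural : forall (s t : P) (h : \val s <= \val t) (x : M s),
      hom_fun t (pm_map h x) = pm_map h (hom_fun s x) }.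

Definition hom_eq (R : realType) (P : set R) (K : fieldType)
    (M N : persmod P K) (f g : pmhom M N) : Prop :=
  forall (s : P) (x : M s), f s x = g s x.

Definition hom_zero (R : realType) (P : set R) (K : fieldType)
    (M N : persmod P K) (f : pmhom M N) : Prop :=
  forall (s : P) (x : M s), f s x = 0.

Lemma hom_comp_natural (R : realType) (P : set R) (K : fieldType)
    (L M N : persmod P K) (g : pmhom M N) (f : pmhom L M)
    (s t : P) (h : \val s <= \val t) (x : L s) :
  (g t \o f t) (pm_map h x) = pm_map h ((g s \o f s) x).
Proof. by rewrite /= !hom_natural. Qed.

Definition hom_comp (R : realType) (P : set R) (K : fieldType)
    (L M N : persmod P K) (g : pmhom M N) (f : pmhom L M) : pmhom L N :=
  @PMHom R P K L N (fun s => (g s \o f s : {linear L s -> N s}))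
    (hom_comp_natural g f).

Definition epimorphism (R : realType) (P : set R) (K : fieldType)
    (M N : persmod P K) (f : pmhom M N) : Prop :=
  forall (Q : persmod P K) (g h : pmhom N Q),
    hom_eq (hom_comp g f) (hom_comp h f) -> hom_eq g h.

Definition isomorphic (R : realType) (P : set R) (K : fieldType)
    (M N : persmod P K) : Prop :=
  exists (f : pmhom M N) (g : pmhom N M),
    (forall (s : P) (x : M s), g s (f s x) = x) /\
    (forall (s : P) (y : N s), f s (g s y) = y).

Definition zero_module (R : realType) (P : set R) (K : fieldType)
    (M : persmod P K) : Prop :=
  forall (s : P) (x : M s), x = 0.

Record interval_in (R : realType) (P : set R) := IntervalIn {
  itv_set :> set P;
  itv_nonempty : itv_set !=set0;
  itv_convex : forall s t u : P, \val s <= \val t -> \val t <= \val u ->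
    itv_set s -> itv_set u -> itv_set t }.

(* The infimum is taken in the extended reals, so that it always exists and an
   interval unbounded below has infimum -oo, which it does not contain. *)
Definition ext_set (R : realType) (P : set R) (I : set P) : set (\bar R) :=
  [set (\val s)%:E | s in I].

Definition same_left_end (R : realType) (P : set R) (I J : interval_in P) :
    Prop :=
  ereal_inf (ext_set I) = ereal_inf (ext_set J) /\
  (ext_set I (ereal_inf (ext_set I)) <-> ext_set J (ereal_inf (ext_set J))).

Definition line_obj (K : fieldType) (b : bool) : lmodType K :=
  if b then (K^o : lmodType K) else ('rV[K]_0 : lmodType K).

Definition line_map (K : fieldType) (b c : bool) :
    {linear line_obj K b -> line_obj K c} :=
  match b, c return {linear line_obj K b -> line_obj K c} with
  | true, true => (idfun : {linear K^o -> K^o})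
  | b', c' => (\0 : {linear line_obj K b' -> line_obj K c'})
  end.

Lemma line_map_id (K : fieldType) (b : bool) (x : line_obj K b) :
  line_map K b b x = x.
Proof. by case: b x => //= x; apply/matrixP => i []. Qed.

Lemma line_map_comp (K : fieldType) (b c d : bool) (x : line_obj K b) :
  (b -> d -> c) -> line_map K b d x = line_map K c d (line_map K b c x).
Proof. by case: b x => x; case: c => //; case: d => //= /(_ isT isT). Qed.

Definition interval_obj (R : realType) (P : set R) (K : fieldType)
    (I : interval_in P) (s : P) : lmodType K :=
  line_obj K (s \in itv_set I).

Definition interval_map (R : realType) (P : set R) (K : fieldType)
    (I : interval_in P) (s t : P) (_ : \val s <= \val t) :
    {linear interval_obj K I s -> interval_obj K I t} :=
  line_map K (s \in itv_set I) (t \in itv_set I).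

Lemma interval_map_id (R : realType) (P : set R) (K : fieldType)
    (I : interval_in P) (s : P) (h : \val s <= \val s)
    (x : interval_obj K I s) :
  interval_map K I h x = x.
Proof. exact: line_map_id. Qed.

Lemma interval_map_comp (R : realType) (P : set R) (K : fieldType)
    (I : interval_in P) (s t u : P) (hst : \val s <= \val t)
    (htu : \val t <= \val u) (hsu : \val s <= \val u)
    (x : interval_obj K I s) :
  interval_map K I hsu x = interval_map K I htu (interval_map K I hst x).
Proof.
apply: line_map_comp => /set_mem Is /set_mem Iu; apply/mem_set.
exact: (itv_convex hst htu Is Iu).
Qed.

Definition interval_module (R : realType) (P : set R) (K : fieldType)
    (I : interval_in P) : persmod P K :=
  @PersMod R P K (interval_obj K I) (@interval_map R P K I)
    (@interval_map_id R P K I) (@interval_map_comp R P K I).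

Definition is_interval_module (R : realType) (P : set R) (K : fieldType)
    (M : persmod P K) : Prop :=
  exists I : interval_in P, isomorphic M (interval_module K I).

(* The interval of an interval module is determined by its support, so the
   choice of I and J here is immaterial. *)
Definition same_left_end_mod (R : realType) (P : set R) (K : fieldType)
    (M N : persmod P K) : Prop :=
  exists I J : interval_in P,
    [/\ isomorphic M (interval_module K I),
        isomorphic N (interval_module K J) & same_left_end I J].

Record subspace (K : fieldType) (V : lmodType K) := Subspace {
  ss_pred : {pred V};
  ss_closed : submod_closed ss_pred }.

HB.instance Definition _ (K : fieldType) (V : lmodType K) (S : subspace V) :=
  GRing.isSubmodClosed.Build K V (ss_pred S) (ss_closed S).

Definition ss_type (K : fieldType) (V : lmodType K) (S : subspace V) : Type :=
  {x : V | x \in ss_pred S}.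

HB.instance Definition _ (K : fieldType) (V : lmodType K) (S : subspace V) :=
  SubChoice.on (ss_type S).
HB.instance Definition _ (K : fieldType) (V : lmodType K) (S : subspace V) :=
  [SubChoice_isSubLmodule of ss_type S by <:].

Record submodule (R : realType) (P : set R) (K : fieldType)
    (M : persmod P K) := Submodule {
  sub_space : forall s : P, subspace (M s);
  sub_map : forall (s t : P) (h : \val s <= \val t) (x : M s),
    x \in ss_pred (sub_space s) -> pm_map h x \in ss_pred (sub_space t) }.

Definition subm_obj (R : realType) (P : set R) (K : fieldType)
    (M : persmod P K) (S : submodule M) (s : P) : lmodType K :=
  ss_type (sub_space S s).

Definition subm_fun (R : realType) (P : set R) (K : fieldType)
    (M : persmod P K) (S : submodule M) (s t : P) (h : \val s <= \val t)
    (x : subm_obj S s) : subm_obj S t :=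
  exist _ (pm_map h (\val x)) (sub_map h (valP x)).

Lemma subm_fun_linear (R : realType) (P : set R) (K : fieldType)
    (M : persmod P K) (S : submodule M) (s t : P) (h : \val s <= \val t) :
  linear (@subm_fun R P K M S s t h).
Proof. by move=> a x y; apply: val_inj; rewrite /= !linearP. Qed.

HB.instance Definition _ (R : realType) (P : set R) (K : fieldType)
    (M : persmod P K) (S : submodule M) (s t : P) (h : \val s <= \val t) :=
  GRing.isLinear.Build K (subm_obj S s) (subm_obj S t) _
    (@subm_fun R P K M S s t h) (subm_fun_linear h).

Lemma subm_id (R : realType) (P : set R) (K : fieldType)
    (M : persmod P K) (S : submodule M) (s : P) (h : \val s <= \val s)
    (x : subm_obj S s) :
  subm_fun h x = x.
Proof. by apply: val_inj; rewrite /= pm_id. Qed.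

Lemma subm_comp (R : realType) (P : set R) (K : fieldType)
    (M : persmod P K) (S : submodule M) (s t u : P) (hst : \val s <= \val t)
    (htu : \val t <= \val u) (hsu : \val s <= \val u) (x : subm_obj S s) :
  subm_fun hsu x = subm_fun htu (subm_fun hst x).
Proof. by apply: val_inj; rewrite /= (pm_comp hst htu). Qed.

Definition subm_mod (R : realType) (P : set R) (K : fieldType)
    (M : persmod P K) (S : submodule M) : persmod P K :=
  @PersMod R P K (subm_obj S)
    (fun s t h => (@subm_fun R P K M S s t h : {linear _ -> _}))
    (@subm_id R P K M S) (@subm_comp R P K M S).

Coercion subm_mod : submodule >-> persmod.

Definition incl_fun (R : realType) (P : set R) (K : fieldType)
    (M : persmod P K) (S : submodule M) (s : P) (x : subm_mod S s) : M s :=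
  \val (x : ss_type (sub_space S s)).

Lemma incl_fun_linear (R : realType) (P : set R) (K : fieldType)
    (M : persmod P K) (S : submodule M) (s : P) :
  linear (@incl_fun R P K M S s).
Proof. by []. Qed.

HB.instance Definition _ (R : realType) (P : set R) (K : fieldType)
    (M : persmod P K) (S : submodule M) (s : P) :=
  GRing.isLinear.Build K (subm_mod S s) (M s) _
    (@incl_fun R P K M S s) (@incl_fun_linear R P K M S s).

Lemma incl_natural (R : realType) (P : set R) (K : fieldType)
    (M : persmod P K) (S : submodule M) (s t : P) (h : \val s <= \val t)
    (x : subm_mod S s) :
  incl_fun (pm_map h x) = pm_map h (incl_fun x).
Proof. by []. Qed.

Definition sub_incl (R : realType) (P : set R) (K : fieldType)
    (M : persmod P K) (S : submodule M) : pmhom S M :=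
  @PMHom R P K S M (fun s => (@incl_fun R P K M S s : {linear _ -> _}))
    (@incl_natural R P K M S).

Definition internal_direct_sum (R : realType) (P : set R) (K : fieldType)
    (M : persmod P K) (A : finType) (Ma : A -> submodule M) : Prop :=
  forall (s : P) (x : M s),
    exists! m : (forall a : A, Ma a s),
      x = \sum_(a : A) sub_incl (Ma a) s (m a).

Definition decomp (R : realType) (P : set R) (K : fieldType)
    (M : persmod P K) (A : finType) (Ma : A -> submodule M)
    (D : internal_direct_sum Ma) (s : P) (x : M s) :
    forall a : A, Ma a s :=
  sval (cid (D s x)).

Lemma decomp_sum (R : realType) (P : set R) (K : fieldType)
    (M : persmod P K) (A : finType) (Ma : A -> submodule M)
    (D : internal_direct_sum Ma) (s : P) (x : M s) :
  x = \sum_(a : A) sub_incl (Ma a) s (decomp D x a).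
Proof. by rewrite /decomp; case: cid => m []. Qed.

Lemma decomp_uniq (R : realType) (P : set R) (K : fieldType)
    (M : persmod P K) (A : finType) (Ma : A -> submodule M)
    (D : internal_direct_sum Ma) (s : P) (x : M s)
    (m : forall a : A, Ma a s) :
  x = \sum_(a : A) sub_incl (Ma a) s (m a) -> decomp D x = m.
Proof. exact: (proj2 (svalP (cid (D s x)))). Qed.

Definition proj_fun (R : realType) (P : set R) (K : fieldType)
    (M : persmod P K) (A : finType) (Ma : A -> submodule M)
    (D : internal_direct_sum Ma) (a : A) (s : P) (x : M s) : Ma a s :=
  decomp D x a.

Lemma proj_fun_linear (R : realType) (P : set R) (K : fieldType)
    (M : persmod P K) (A : finType) (Ma : A -> submodule M)
    (D : internal_direct_sum Ma) (a : A) (s : P) :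
  linear (@proj_fun R P K M A Ma D a s).
Proof.
move=> k x y.
suff H : decomp D (k *: x + y) = fun b => k *: decomp D x b + decomp D y b.
  by rewrite /proj_fun H.
apply: decomp_uniq; rewrite {1}(decomp_sum D x) {1}(decomp_sum D y).
rewrite scaler_sumr -big_split /=.
by apply: eq_bigr => b _; rewrite linearP.
Qed.

HB.instance Definition _ (R : realType) (P : set R) (K : fieldType)
    (M : persmod P K) (A : finType) (Ma : A -> submodule M)
    (D : internal_direct_sum Ma) (a : A) (s : P) :=
  GRing.isLinear.Build K (M s) (Ma a s) _
    (@proj_fun R P K M A Ma D a s) (@proj_fun_linear R P K M A Ma D a s).

Lemma proj_natural (R : realType) (P : set R) (K : fieldType)
    (M : persmod P K) (A : finType) (Ma : A -> submodule M)
    (D : internal_direct_sum Ma) (a : A) (s t : P) (h : \val s <= \val t)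
    (x : M s) :
  proj_fun D a (pm_map h x) = pm_map h (proj_fun D a x).
Proof.
suff H : decomp D (pm_map h x) = fun b => pm_map h (decomp D x b).
  by rewrite /proj_fun H.
apply: decomp_uniq; rewrite {1}(decomp_sum D x) linear_sum.
by apply: eq_bigr => b _; rewrite hom_natural.
Qed.

Definition dsum_proj (R : realType) (P : set R) (K : fieldType)
    (M : persmod P K) (A : finType) (Ma : A -> submodule M)
    (D : internal_direct_sum Ma) (a : A) : pmhom M (Ma a) :=
  @PMHom R P K M (Ma a)
    (fun s => (@proj_fun R P K M A Ma D a s : {linear _ -> _}))
    (@proj_natural R P K M A Ma D a).

Definition finitely_interval_decomposable (R : realType) (P : set R)
    (K : fieldType) (M : persmod P K) : Prop :=
  exists (A : finType) (Ma : A -> submodule M),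
    internal_direct_sum Ma /\ forall a : A, is_interval_module (Ma a).

(* Main.v *)
(* The conditions only involve the blocks of [f] between intervals with a common
   left end.  Close to a left end, intervals starting later are not yet alive and
   intervals starting earlier map to zero, so testing the epimorphism [f] against
   the interval module of [{s <= t}], with [t] close to the left end, shows that
   the matrix of [f] between intervals with that left end has full row rank.
   Among intervals with a common left end, adding a multiple of a generator to
   the generator of a longer interval is an automorphism.  Pivoting on the longest
   remaining interval of [N] and the shortest interval of [M] mapping onto it, the
   row and the column of the pivot are cleared by such operations only; at the end
   every row and every matched column has a single nonzero entry. *)
From HB Require Import structures.
Require Import Defs.
From mathcomp Require Import all_boot all_order all_algebra.
From mathcomp Require Import all_classical all_reals ereal.

Set Implicit Arguments.
Unset Strict Implicit.
Unset Printing Implicit Defensive.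

Import Order.TTheory GRing.Theory Num.Theory.

Local Open Scope classical_set_scope.
Local Open Scope ring_scope.


(** * Pivoting with matrices supported on a preorder *)

(** For a preorder [r], a unit of its incidence algebra. The inverse is carried along, so that its
    support never has to be derived. *)
Definition incidence (K : fieldType) (m : nat) (r : rel 'I_m) (A B : 'M[K]_m) :=
  [/\ A *m B = 1%:M, forall i j, A i j != 0 -> r i j &
      forall i j, B i j != 0 -> r i j].

Section NormalForm.
Context (K : fieldType).

Lemma sum_neq0 (I : finType) (F : I -> K) : \sum_i F i != 0 ->
  exists i, F i != 0.
Proof.
move=> h; apply/existsP; rewrite -[X in is_true X]negbK; apply/negP.
rewrite negb_exists => /forallP h0; move/negP: h; apply; apply/eqP.
by apply: big1 => i _; apply/eqP; move: (h0 i); rewrite negbK.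
Qed.

Lemma incidence1 m (r : rel 'I_m) : reflexive r -> incidence (K:=K) r 1%:M 1%:M.
Proof.
move=> rr; split; first by rewrite mulmx1.
- by move=> i j; rewrite mxE; case: (i =P j) => [->|_] //; rewrite eqxx.
- by move=> i j; rewrite mxE; case: (i =P j) => [->|_] //; rewrite eqxx.
Qed.

Lemma incidence_mul m (r : rel 'I_m) (A A' B B' : 'M[K]_m) : transitive r ->
  incidence r A A' -> incidence r B B' -> incidence r (A *m B) (B' *m A').
Proof.
move=> rt [hA sA sA'] [hB sB sB'].
have supp (C D : 'M[K]_m) : (forall i j, C i j != 0 -> r i j) ->
  (forall i j, D i j != 0 -> r i j) -> forall i j, (C *m D) i j != 0 -> r i j.
  move=> sC sD i j; rewrite mxE => /sum_neq0 [k].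
  by rewrite mulf_eq0 negb_or => /andP [/sC h1 /sD h2]; apply: rt h2.
split; [|exact: supp|exact: supp].
by rewrite mulmxA -(mulmxA A) hB mulmx1.
Qed.

Lemma incidence_sym m (r : rel 'I_m) (A B : 'M[K]_m) :
  incidence r A B -> incidence r B A.
Proof. by move=> [h sA sB]; split=> //; apply: mulmx1C. Qed.

(** As [u *m v = 0], the square of [v *m u] vanishes. With [v] or [u] a unit vector this is a
    simultaneous column or row operation. *)
Lemma incidence_rank1 m (r : rel 'I_m) (v : 'cV[K]_m) (u : 'rV[K]_m) :
  reflexive r -> u *m v = 0 ->
  (forall i j, v i 0 * u 0 j != 0 -> r i j) ->
  incidence r (1%:M - v *m u) (1%:M + v *m u).
Proof.
move=> rr uv h.
have vu i j : (v *m u) i j = v i 0 * u 0 j by rewrite mxE big_ord1.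
have supp (i j : 'I_m) (x : K) : (i == j)%:R + x != 0 ->
    (x != 0 -> r i j) -> r i j.
  case: (i =P j) => [-> //|_]; rewrite add0r => xN0; exact.
split.
- rewrite mulmxBl mulmxDr mulmx1 mul1mx mulmxDr mulmx1 mulmxA -(mulmxA v) uv.
  by rewrite mulmx0 mul0mx addr0 addrK.
- move=> i j; rewrite 2!mxE [X in _ + X]mxE vu => /supp; apply.
  by rewrite oppr_eq0; apply: h.
- by move=> i j; rewrite 2!mxE vu => /supp; apply; apply: h.
Qed.

(** Take [j] with the most predecessors. If [r j k], the predecessors of [j] are among those of [k],
    so both sets agree, and [k], its own predecessor, is below [j]. *)
Lemma preorder_max (d : nat) (r : rel 'I_d) (X : pred 'I_d) (j0 : 'I_d) :
  reflexive r -> transitive r -> X j0 ->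
  exists2 j, X j & forall k, X k -> r k j || r j k -> r k j.
Proof.
move=> rr rt Xj0.
case: (arg_maxnP (fun j => #|[pred l | r l j]|) Xj0) => j Xj jmax.
exists j => // k Xk /orP [//|rjk].
have sub : [pred l | r l j] \subset [pred l | r l k].
  by apply/fintype.subsetP => l; rewrite !inE => rlj; apply: rt rjk.
have : [pred l | r l j] =i [pred l | r l k].
  by apply/subset_cardP => //; apply/eqP; rewrite eqn_leq subset_leq_card //=;
    apply: jmax.
by move/(_ k); rewrite !inE rr.
Qed.

(** Columns stand for intervals of the source, rows for intervals of the target, colours for left
    ends, and [rA], [rB] for inclusion at a common left end. *)
Variables (m n : nat) (C : Type) (cA : 'I_m -> C) (cB : 'I_n -> C).
Variables (rA : rel 'I_m) (rB : rel 'I_n).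
Hypotheses (rA_refl : reflexive rA) (rA_trans : transitive rA).
Hypotheses (rB_refl : reflexive rB) (rB_trans : transitive rB).
Hypothesis (rA_total : forall i k, cA i = cA k -> rA i k || rA k i).
Hypothesis (rB_total : forall i k, cB i = cB k -> rB i k || rB k i).

Definition reduced_at (s : 'I_n -> 'I_m) (F : 'M[K]_(n, m)) (j : 'I_n) :=
  (forall i, (F j i != 0) = (i == s j)) /\ (forall k, (F k (s j) != 0) = (k == j)).

(** The pivot row [j] is maximal outside [S], and the pivot column [i] is minimal among the nonzero
    entries of that row. Clearing the row changes only columns above [i], clearing the column
    changes only rows below [j]; these are the operations that [rA] and [rB] permit. *)
Lemma pivot_step (F : 'M[K]_(n, m)) (S : {set 'I_n}) (s : 'I_n -> 'I_m)
    (j0 : 'I_n) :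
  (forall j i, F j i != 0 -> cB j = cA i) -> row_free F ->
  (forall j, j \in S -> reduced_at s F j) -> j0 \notin S ->
  exists (Q Q' : 'M[K]_n) (P P' : 'M[K]_m) j s',
    [/\ incidence rB Q Q', incidence rA P P', j \notin S,
      forall k i, (Q *m F *m P) k i != 0 -> cB k = cA i &
      forall k, k \in j |: S -> reduced_at s' (Q *m F *m P) k].
Proof.
move=> Fcl Ffree red j0S.
have [j jS jmax] := @preorder_max _ _ (fun j => j \notin S) j0 rB_refl rB_trans j0S.
have [i0 Fji0] : exists i, F j i != 0.
  apply/existsP; rewrite -[X in is_true X]negbK; apply/negP.
  rewrite negb_exists => /forallP h0.
  have : delta_mx 0 j *m F = (0 : 'rV_m).
    by rewrite -rowE; apply/rowP => i; rewrite !mxE; apply/eqP;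
      move: (h0 i); rewrite negbK.
  move/(congr1 (mulmx^~ (pinvmx F))); rewrite mul0mx -mulmxA mulmxVp // mulmx1.
  by move/rowP/(_ j)/eqP; rewrite !mxE !eqxx oner_eq0.
have [i Fji imin] := @preorder_max _ (fun a b => rA b a) (fun i => F j i != 0) i0
  rA_refl (fun a b c h h' => rA_trans h' h) Fji0.
have {}imin l : F j l != 0 -> rA i l.
  by move=> Fjl; apply: (imin _ Fjl); apply: rA_total;
    rewrite -(Fcl _ _ Fjl) (Fcl _ _ Fji).
(* Column [s k] has its only nonzero entry in row [k], whereas column [i] has one in row [j],
   outside [S]. *)
have iS k : k \in S -> i != s k.
  move=> kS; apply/eqP => e; have [_ /(_ j)] := red k kS.
  by rewrite -e Fji; case: eqP jS => // ->; rewrite kS.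
have FS k : k \in S -> F k i = 0.
  move=> kS; have [/(_ i)] := red k kS; rewrite (negbTE (iS k kS)) => h _.
  by apply/eqP; rewrite -[_ == _]negbK h.
have {}jmax k : F k i != 0 -> rB k j.
  move=> Fki; apply: jmax; last by apply: rB_total; rewrite (Fcl _ _ Fki) (Fcl _ _ Fji).
  by apply/negP => /FS; apply/eqP.
(* The zeros at [i] and [j] give [u *m delta_mx i 0 = 0] and [delta_mx 0 j *m w = 0], as
   [incidence_rank1] demands. *)
pose u : 'rV[K]_m := \row_l (if l == i then 0 else F j l / F j i).
pose w : 'cV[K]_n := \col_k (if k == j then 0 else F k i / F j i).
have incP : incidence rA (1%:M - delta_mx i 0 *m u) (1%:M + delta_mx i 0 *m u).
  apply: incidence_rank1 => //.
    apply/matrixP => a b; rewrite !mxE (bigD1 i) //= !mxE !eqxx mul0r add0r.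
    by apply: big1 => k /negbTE ki; rewrite [X in _ * X]mxE ki mulr0.
  move=> a b; rewrite !mxE eqxx andbT.
  case: (a =P i) => [->|_]; last by rewrite mul0r eqxx.
  rewrite mul1r; case: (b =P i) => [->|_]; first by rewrite eqxx.
  by move=> h; apply: imin; apply: contraNneq h => ->; rewrite mul0r.
have incQ : incidence rB (1%:M - w *m delta_mx 0 j) (1%:M + w *m delta_mx 0 j).
  apply: incidence_rank1 => //.
    apply/matrixP => a b; rewrite !mxE (bigD1 j) //= !mxE !eqxx mulr0 add0r.
    by apply: big1 => k /negbTE ki; rewrite mxE ki andbF mul0r.
  move=> a b; rewrite !mxE eqxx andTb.
  case: (b =P j) => [->|_]; last by rewrite mulr0 eqxx.
  rewrite mulr1; case: (a =P j) => [->|_]; first by rewrite eqxx.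
  by move=> h; apply: jmax; apply: contraNneq h => ->; rewrite mul0r.
set Q := 1%:M - _ in incQ; set P := 1%:M - _ in incP.
have FE k l : (Q *m F *m P) k l =
  if k == j then (if l == i then F j i else 0)
  else (if l == i then 0 else F k l - F k i * (F j l / F j i)).
  have HE k' : (F *m P) k' l = F k' l - F k' i * u 0 l.
    rewrite mulmxBr mulmx1 mulmxA 2!mxE; congr (_ - _).
    by rewrite -colE mxE big_ord1 mxE.
  rewrite -mulmxA mulmxBl mul1mx -mulmxA -rowE mxE [X in _ + X]mxE.
  rewrite [X in _ - X](_ : _ = w k 0 * (F *m P) j l); last first.
    by rewrite mxE big_ord1 [X in _ * X]mxE.
  rewrite !HE !mxE; case: (k =P j) => [->|_]; case: (l =P i) => [->|_].
  - by rewrite mulr0 mul0r !subr0.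
  - by rewrite mul0r subr0 mulrCA divff // mulr1 subrr.
  - by rewrite !mulr0 !subr0 divfK // subrr.
  - by rewrite [F j i * _]mulrCA divff // mulr1 subrr mulr0 subr0.
exists Q, (1%:M + w *m delta_mx 0 j), P, (1%:M + delta_mx i 0 *m u), j.
exists (fun k => if k == j then i else s k); split=> //.
  move=> k l; rewrite FE.
  case: (k =P j) => [->|_]; case: (l =P i) => [->|_]; rewrite ?eqxx //.
    by move=> _; apply: Fcl.
  (* A newly created entry has nonzero [F k i] and [F j l], and the pivot [F j i] links their
     colours. *)
  have [-> h|Fkl _] := eqVneq (F k l) 0; last exact: Fcl.
  have Fki : F k i != 0 by apply: contraNneq h => ->; rewrite mul0r subr0.
  have Fjl : F j l != 0 by apply: contraNneq h => ->; rewrite mul0r mulr0 subr0.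
  by rewrite (Fcl _ _ Fki) -(Fcl _ _ Fji) (Fcl _ _ Fjl).
move=> k; rewrite in_setU1; have [-> _|kj /= kS] := eqVneq k j.
  split=> [l|k']; rewrite eqxx FE ?eqxx.
    by case: (l =P i) => _; rewrite ?Fji // eqxx.
  by case: (k' =P j) => _; rewrite ?Fji // eqxx.
(* Earlier pivots survive: row [k] is untouched because [F k i = 0], column [s k] because
   [F j (s k) = 0]. *)
have [r1 r2] := red k kS; split=> [l|k']; rewrite (negbTE kj) FE.
  rewrite (negbTE kj) -r1 FS // mul0r subr0.
  by case: (l =P i) => [->|//]; rewrite FS.
rewrite [s k == i]eq_sym (negbTE (iS k kS)) -r2; case: (k' =P j) => [->|_].
  by rewrite r2 eq_sym (negbTE kj) eqxx.
suff -> : F j (s k) = 0 by rewrite mul0r mulr0 subr0.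
by apply/eqP; rewrite -[_ == _]negbK r2 eq_sym (negbTE kj).
Qed.

Lemma matrix_normal_form (F : 'M[K]_(n, m)) :
  (forall j i, F j i != 0 -> cB j = cA i) -> row_free F ->
  exists (Q Q' : 'M[K]_n) (P P' : 'M[K]_m) s,
    [/\ incidence rB Q Q', incidence rA P P' &
      forall k, reduced_at s (Q *m F *m P) k].
Proof.
move=> Fcl Ffree.
(* This supplies some initial map [s]; its values are arbitrary while [S] is empty. *)
have nm : (n <= m)%N by rewrite -(eqP Ffree) rank_leq_col.
suff main d : forall (S : {set 'I_n}) (s : 'I_n -> 'I_m) (F' : 'M[K]_(n, m)),
    (#|~: S| <= d)%N -> (forall j i, F' j i != 0 -> cB j = cA i) ->
    row_free F' -> (forall j, j \in S -> reduced_at s F' j) ->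
  exists (Q Q' : 'M[K]_n) (P P' : 'M[K]_m) s,
    [/\ incidence rB Q Q', incidence rA P P' &
      forall k, reduced_at s (Q *m F' *m P) k].
  by apply: (main _ finset.set0 (widen_ord nm)) => // j; rewrite inE.
elim: d => [|d IH] S s {Fcl Ffree}F Sd Fcl Ffree red.
  exists 1%:M, 1%:M, 1%:M, 1%:M, s; split; [exact: incidence1|exact: incidence1|].
  move=> k; rewrite mulmx1 mul1mx; apply: red.
  by move: Sd; rewrite leqn0 cards_eq0 => /eqP/setP/(_ k); rewrite !inE => /negbFE.
have [/finset.setP full|[j0 j0S]] : S = finset.setT \/ exists j0, j0 \notin S.
  case: (pickP (fun j => j \notin S)) => [j jS|h]; first by right; exists j.
  by left; apply/finset.setP => k; rewrite inE; apply: negbFE; exact: h.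
  exists 1%:M, 1%:M, 1%:M, 1%:M, s; split; [exact: incidence1|exact: incidence1|].
  by move=> k; rewrite mulmx1 mul1mx; apply: red; rewrite full inE.
have [Q [Q' [P [P' [j [s' [incQ incP jS cl' red']]]]]]] := pivot_step Fcl Ffree red j0S.
have free' : row_free (Q *m F *m P).
  have [QQ' _ _] := incQ; have [PP' _ _] := incP.
  apply/row_freeP; have [F1 FF1] := row_freeP Ffree; exists (P' *m F1 *m Q').
  by rewrite !mulmxA -(mulmxA _ P) PP' mulmx1 -(mulmxA _ F) FF1 mulmx1.
have [|Q1 [Q1' [P1 [P1' [s1 [incQ1 incP1 red1]]]]]] := IH (j |: S) s' _ _ cl' free' red'.
  rewrite finset.setCU -ltnS; apply: leq_trans Sd.
  by apply: proper_card; rewrite finset.setIC -finset.setDE finset.properD1 // inE.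
exists (Q1 *m Q), (Q' *m Q1'), (P *m P1), (P1' *m P'), s1; split.
- exact: incidence_mul.
- exact: incidence_mul.
- by move=> k; move: (red1 k); rewrite !mulmxA.
Qed.
End NormalForm.


(** * Left ends as up-closures *)

Section LeftEnds.
Context (R : realType) (P : set R).
Implicit Types (I J : interval_in P) (s t : P).

(** The up-closure in [P] determines the left end and is determined by it, so equality of sets can
    replace the comparison of infima. *)
Definition upset I : set P := [set t | exists2 s, itv_set I s & \val s <= \val t].

Lemma upset_le I s t : upset I s -> \val s <= \val t -> upset I t.
Proof. by move=> [u Iu us] st; exists u => //; apply: le_trans st. Qed.

Lemma sub_upset I s : itv_set I s -> upset I s.
Proof. by move=> Is; exists s. Qed.

Lemma upset_interval I s t :
  itv_set I t -> \val s <= \val t -> upset I s -> itv_set I s.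
Proof. by move=> It st [u Iu us]; apply: itv_convex us st Iu It. Qed.

Lemma upset_same_left_end I J : upset I = upset J -> same_left_end I J.
Proof.
move=> IJ.
have inf_le (I' J' : interval_in P) : upset I' = upset J' ->
    (ereal_inf (ext_set I') <= ereal_inf (ext_set J'))%E.
  move=> e; apply: le_ereal_inf_tmp => _ [s J's <-].
  have [u I'u us] : upset I' s by rewrite e; exact: sub_upset.
  by apply: ge_ereal_inf; exists (\val u)%:E; [exists u|rewrite lee_fin].
have e : ereal_inf (ext_set I) = ereal_inf (ext_set J).
  by apply/eqP; rewrite eq_le !inf_le.
have mem (I' J' : interval_in P) : upset I' = upset J' ->
    ereal_inf (ext_set I') = ereal_inf (ext_set J') ->
    ext_set I' (ereal_inf (ext_set I')) -> ext_set J' (ereal_inf (ext_set J')).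
  move=> e1 e2 [s I's es].
  have [u J'u us] : upset J' s by rewrite -e1; exact: sub_upset.
  exists u => //; rewrite -e2 -es; congr (_%:E); apply/eqP; rewrite eq_le us /=.
  by rewrite -lee_fin es e2; apply: ereal_inf_lbound; exists u.
by split=> //; split; apply: mem.
Qed.

(** A point [s] of one interval either is the infimum, which then lies in the other interval too, or
    is strictly above it, hence above a point of the other interval. *)
Lemma same_left_end_upset I J : same_left_end I J -> upset I = upset J.
Proof.
have sub (I' J' : interval_in P) :
    ereal_inf (ext_set I') = ereal_inf (ext_set J') ->
    (ext_set I' (ereal_inf (ext_set I')) -> ext_set J' (ereal_inf (ext_set J'))) ->
    upset I' `<=` upset J'.
  move=> e1 e2 t [s I's st]; apply: upset_le st.
  have ge : (ereal_inf (ext_set I') <= (\val s)%:E)%E.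
    by apply: ereal_inf_lbound; exists s.
  have [es|ne] := eqVneq (ereal_inf (ext_set I')) (\val s)%:E.
    have [|u J'u eu] := e2; first by rewrite es; exists s.
    by exists u => //; rewrite -lee_fin eu -e1 es.
  have : (ereal_inf (ext_set J') < (\val s)%:E)%E by rewrite -e1 lt_neqAle ne.
  case/ereal_inf_lt => _ [u J'u <-]; rewrite lte_fin => /ltW us.
  by exists u.
by move=> [e1 [e2 e3]]; apply/seteqP; split; apply: sub.
Qed.

Definition incl_rel n (I : 'I_n -> interval_in P) : rel 'I_n :=
  [rel i j | `[< upset (I i) = upset (I j) /\ itv_set (I i) `<=` itv_set (I j) >]].

Lemma incl_rel_refl n (I : 'I_n -> interval_in P) : reflexive (incl_rel I).
Proof. by move=> i; apply/asboolP; split. Qed.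

Lemma incl_rel_trans n (I : 'I_n -> interval_in P) : transitive (incl_rel I).
Proof.
move=> j i k /asboolP[e1 s1] /asboolP[e2 s2]; apply/asboolP; split.
  by rewrite e1.
exact: subset_trans s1 s2.
Qed.

(** If [s] lies in the first interval only, every point of the second is below [s] and, the left
    ends being equal, belongs to the first. *)
Lemma incl_rel_total n (I : 'I_n -> interval_in P) i j :
  upset (I i) = upset (I j) -> incl_rel I i j || incl_rel I j i.
Proof.
move=> e; have [sub|/existsNP[s /not_implyP[Is Js]]] :=
  pselect (itv_set (I i) `<=` itv_set (I j)).
  by apply/orP; left; apply/asboolP; split.
apply/orP; right; apply/asboolP; split=> // t Jt.
apply: (upset_interval Is); last by rewrite e; exact: sub_upset.
have [//|/ltW st] := leP (\val t) (\val s).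
by case: Js; apply: upset_interval Jt st _; rewrite -e; exact: sub_upset.
Qed.

End LeftEnds.

(* Values of [coord i s] at points [s] outside [itv i] carry no information. *)
Record interval_basis (R : realType) (P : set R) (K : fieldType)
    (M : persmod P K) (n : nat) := IntervalBasis {
  itv : 'I_n -> interval_in P;
  gen : 'I_n -> forall s, M s;
  coord : 'I_n -> forall s, M s -> K;
  coord_linear : forall i s k x y,
    @coord i s (k *: x + y) = k * @coord i s x + @coord i s y;
  gen_out : forall i s, ~ itv_set (itv i) s -> gen i s = 0;
  gen_map : forall i s t (h : \val s <= \val t), itv_set (itv i) s ->
    pm_map h (gen i s) = gen i t;
  coord_gen : forall i j s, itv_set (itv i) s -> @coord i s (gen j s) = (i == j)%:R;
  coord_sum : forall s x, x = \sum_i @coord i s x *: gen i s }.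

Arguments itv {R P K M n} b i : rename.
Arguments gen {R P K M n} b i s : rename.
Arguments coord {R P K M n} b i {s} x : rename.

(** * Coordinates in an interval basis and change of basis *)

Section Basis.
Context (R : realType) (P : set R) (K : fieldType) (M : persmod P K) (n : nat).
Implicit Types (B : interval_basis M n) (s t : P).

Lemma coordD B i s x y : @coord _ _ _ _ _ B i s (x + y) = coord B i x + coord B i y.
Proof. by rewrite -[x]scale1r coord_linear mul1r scale1r. Qed.

Lemma coord0 B i s : coord B i (0 : M s) = 0.
Proof. by apply: (addrI (coord B i (0 : M s))); rewrite -coordD !addr0. Qed.

Lemma coordZ B i s k x : @coord _ _ _ _ _ B i s (k *: x) = k * coord B i x.
Proof. by rewrite -[k *: x]addr0 coord_linear coord0 addr0. Qed.

Lemma coord_bigsum B i s (T : Type) (r : seq T) (p : pred T) (F : T -> M s) :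
  coord B i (\sum_(k <- r | p k) F k) = \sum_(k <- r | p k) coord B i (F k).
Proof.
by elim/big_rec2: _ => [|k y1 y2 _ <-]; rewrite ?coord0 // coordD.
Qed.

Lemma gen_map_out B i s t (h : \val s <= \val t) : ~ itv_set (itv B i) s ->
  pm_map h (gen B i s) = 0.
Proof. by move=> /gen_out ->; rewrite linear0. Qed.

Lemma coord_map B i s t (h : \val s <= \val t) x :
  itv_set (itv B i) s -> itv_set (itv B i) t ->
  coord B i (pm_map h x) = coord B i x.
Proof.
move=> Is It; rewrite {1}(coord_sum B x) linear_sum coord_bigsum.
rewrite (bigD1 i) //= linearZ coordZ gen_map // coord_gen // eqxx mulr1.
rewrite big1 ?addr0 // => j ji; rewrite linearZ coordZ.
have [Js|Js] := pselect (itv_set (itv B j) s); last by rewrite gen_map_out // coord0 mulr0.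
by rewrite gen_map // coord_gen // eq_sym (negbTE ji) mulr0.
Qed.

Lemma coord_map_out B i s t (h : \val s <= \val t) x :
  ~ itv_set (itv B i) s -> itv_set (itv B i) t -> coord B i (pm_map h x) = 0.
Proof.
move=> Is It; rewrite {1}(coord_sum B x) linear_sum coord_bigsum.
rewrite big1 // => j _; rewrite linearZ coordZ.
have [Js|Js] := pselect (itv_set (itv B j) s); last by rewrite gen_map_out // coord0 mulr0.
rewrite gen_map // coord_gen //; case: eqP => [ij|_]; last by rewrite mulr0.
by case: Is; rewrite ij.
Qed.

(* The family [\sum_k A k i *: gen k] still lives on [itv i], because [A k i]
   vanishes unless [itv k] is contained in [itv i] with the same left end. *)
Lemma basis_change B (A A' : 'M[K]_n) : incidence (incl_rel (itv B)) A A' ->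
  exists B' : interval_basis M n, [/\ itv B' = itv B,
    forall i s, gen B' i s = \sum_k A k i *: gen B k s &
    forall i s (x : M s), coord B' i x = \sum_k A' i k * coord B k x].
Proof.
move=> [AA' sA sA'].
pose g i s := \sum_k A k i *: gen B k s.
pose c i s (x : M s) := \sum_k A' i k * coord B k x.
have c_lin i s k x y : c i s (k *: x + y) = k * c i s x + c i s y.
  rewrite mulr_sumr -big_split; apply: eq_bigr => j _ /=.
  by rewrite coord_linear mulrDr mulrCA.
have g_out i s : ~ itv_set (itv B i) s -> g i s = 0.
  move=> nIs; apply: big1 => k _.
  have [->|/sA/asboolP[_ sub]] := eqVneq (A k i) 0; first by rewrite scale0r.
  by rewrite gen_out ?scaler0 // => /sub.
have g_map i s t (h : \val s <= \val t) :
    itv_set (itv B i) s -> pm_map h (g i s) = g i t.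
  move=> Is; rewrite linear_sum; apply: eq_bigr => k _; rewrite linearZ /=.
  have [->|/sA/asboolP[e sub]] := eqVneq (A k i) 0; first by rewrite !scale0r.
  have [Ks|Ks] := pselect (itv_set (itv B k) s); first by rewrite gen_map.
  (* Generator [k] is dead at [t] too: the up-closure of [itv B k] contains [s], so being alive at
     [t] would make it alive at [s]. *)
  rewrite gen_map_out // gen_out // => Kt; apply: Ks.
  by apply: upset_interval Kt h _; rewrite e; exact: sub_upset.
have c_g i j s : itv_set (itv B i) s -> c i s (g j s) = (i == j)%:R.
  move=> Is; transitivity ((A' *m A) i j); last by rewrite (mulmx1C AA') mxE.
  rewrite mxE; apply: eq_bigr => k _.
  have [->|/sA'/asboolP[_ sub]] := eqVneq (A' i k) 0; first by rewrite !mul0r.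
  congr (_ * _); rewrite coord_bigsum (bigD1 k) //= coordZ coord_gen ?eqxx ?mulr1.
    rewrite big1 ?addr0 // => l lk; rewrite coordZ coord_gen; last exact: sub.
    by rewrite eq_sym (negbTE lk) mulr0.
  exact: sub.
have c_sum s x : x = \sum_i c i s x *: g i s.
  under eq_bigr => i _ do rewrite scaler_sumr.
  rewrite exchange_big /= {1}(coord_sum B x); apply: eq_bigr => k _.
  under eq_bigr => i _ do rewrite scalerA mulrC mulr_sumr.
  rewrite -scaler_suml exchange_big /=; congr (_ *: _).
  under eq_bigr => l _ do under eq_bigr => i _ do rewrite mulrA.
  under eq_bigr => l _ do rewrite -mulr_suml.
  rewrite (bigD1 k) //= [X in _ + X]big1 => [|l lk].
    by have /matrixP/(_ k k) := AA'; rewrite !mxE eqxx => ->; rewrite mul1r addr0.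
  have /matrixP/(_ k l) := AA'; rewrite !mxE eq_sym (negbTE lk) => ->.
  by rewrite mul0r.
by exists (IntervalBasis c_lin g_out g_map c_g c_sum).
Qed.

End Basis.

(** * Interval modules and the basis given by a decomposition *)

Section IntervalModule.
Context (R : realType) (P : set R) (K : fieldType) (I : interval_in P).
Implicit Types (s t : P).

Definition itv_unit s : interval_module K I s :=
  line_map K true (s \in itv_set I) 1.

Definition itv_coord s : {linear interval_module K I s -> K^o} :=
  line_map K (s \in itv_set I) true.

Lemma itv_module_out s (x : interval_module K I s) : ~ itv_set I s -> x = 0.
Proof.
move=> nIs; move: x; rewrite /= /interval_obj (memNset nIs) /= => x.
by apply/matrixP => i [].
Qed.

Lemma itv_coordK s (x : interval_module K I s) : itv_coord s x *: itv_unit s = x.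
Proof.
move: x; rewrite /itv_coord /itv_unit /= /interval_obj.
by case: (s \in _) => x; [exact: mulr1 | apply/matrixP => i []].
Qed.

Lemma itv_coord_unit s : itv_set I s -> itv_coord s (itv_unit s) = 1.
Proof.
move=> /mem_set; rewrite /itv_coord /itv_unit /= /interval_obj.
by case: (s \in _).
Qed.

Lemma itv_unit_map s t (h : \val s <= \val t) : itv_set I s ->
  pm_map h (itv_unit s) = itv_unit t.
Proof.
move=> /mem_set; rewrite /itv_unit /= /interval_map /interval_obj.
by case: (s \in _) => // _; case: (t \in _).
Qed.

End IntervalModule.

(** The units of the interval modules, carried into [M] by the isomorphisms, are the generators;
    coordinates are read off after projecting to the summands. *)
Lemma decomposition_basis (R : realType) (P : set R) (K : fieldType)
    (M : persmod P K) :
  finitely_interval_decomposable M -> exists n, inhabited (interval_basis M n).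
Proof.
move=> [A [Ma [D Mint]]].
have [I Iiso] := choice Mint.
have fex a := cid (Iiso a); have gex a := cid (svalP (fex a)).
pose f a := sval (fex a); pose g a := sval (gex a).
have fK a s x : g a s (f a s x) = x by have [+ _] := svalP (gex a); apply.
have gK a s x : f a s (g a s x) = x by have [_ +] := svalP (gex a); apply.
exists #|A|; constructor.
pose x (i : 'I_#|A|) s :=
  sub_incl (Ma (enum_val i)) s (g (enum_val i) s (itv_unit K (I (enum_val i)) s)).
pose c (i : 'I_#|A|) s (v : M s) : K :=
  itv_coord K (I (enum_val i)) s (f (enum_val i) s (dsum_proj D (enum_val i) s v)).
have projE a b s (v : Ma b s) : dsum_proj D a s (sub_incl (Ma b) s v) =
    if b =P a is ReflectT e then ecast b (Ma b s) e v else 0.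
  rewrite /= /proj_fun.
  have -> // := @decomp_uniq _ _ _ _ _ _ D s (sub_incl (Ma b) s v) (fun a =>
    if b =P a is ReflectT e then ecast b (Ma b s) e v else 0).
  rewrite (bigD1 b) //= big1 ?addr0.
    by case: eqP => // e; rewrite eq_axiomK.
  by move=> k kb; case: eqP => [e|_]; [rewrite e eqxx in kb | rewrite linear0].
apply: (@IntervalBasis _ _ _ _ _ (fun i => I (enum_val i)) x c).
- by move=> i s k u v; rewrite /c !linearP.
- by move=> i s nIs; rewrite /x (itv_module_out (itv_unit _ _ _) nIs) !linear0.
- by move=> i s t h Is; rewrite /x -!hom_natural itv_unit_map.
- move=> i j s Is; rewrite /c /x projE; case: eqP => [e|ne].
    have ij : j = i by apply: enum_val_inj.
    move: e; rewrite ij => e; rewrite eq_axiomK /= gK eqxx.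
    exact: itv_coord_unit.
  by rewrite !linear0; case: eqP ne => // ->.
move=> s v; rewrite {1}(decomp_sum D v).
rewrite (reindex (enum_val : 'I_#|A| -> A)) /=; last first.
  by apply: onW_bij; apply: enum_val_bij.
apply: eq_bigr => i _; rewrite /c /x.
have unitE a w : sub_incl (Ma a) s w =
    itv_coord K (I a) s (f a s w) *: sub_incl (Ma a) s (g a s (itv_unit K (I a) s)).
  by rewrite -{1}(fK a s w) -{1}(itv_coordK (f a s w)) !linearZ.
exact: unitE.
Qed.


(** * Testing an epimorphism near a left end *)

Section NearLeftEnd.
Context (R : realType) (P : set R).

(** Each condition holds on [L] below some point; the smallest of these finitely many points serves
    for all. *)
Lemma near_left_end (L : set P) (T : finType) (C : T -> P -> Prop) :
  L !=set0 ->
  (forall k, exists2 p, L p & forall t, L t -> \val t <= \val p -> C k t) ->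
  exists2 t, L t & forall k, C k t.
Proof.
move=> [p0 Lp0] Cp.
suff /(_ (enum T)) [p Lp pC] : forall r : seq T, exists2 p, L p &
    forall k, k \in r -> forall t, L t -> \val t <= \val p -> C k t.
  by exists p => // k; apply: pC; rewrite ?mem_enum.
elim=> [|k r [p Lp pC]]; first by exists p0.
have [q Lq qC] := Cp k.
have [qp|/ltW pq] := leP (\val q) (\val p).
- exists q => // l; rewrite in_cons => /predU1P[-> //|lr] t Lt tq.
  by apply: pC => //; apply: le_trans tq qp.
- exists p => // l; rewrite in_cons => /predU1P[->|lr] t Lt tp.
    by apply: qC => //; apply: le_trans tp pq.
  exact: pC.
Qed.

Definition below_set (t0 : P) : set P := [set t | \val t <= \val t0].

Lemma below_set_nonempty t0 : below_set t0 !=set0.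
Proof. by exists t0; rewrite /below_set /=. Qed.

Lemma below_set_convex t0 s t u : \val s <= \val t -> \val t <= \val u ->
  below_set t0 s -> below_set t0 u -> below_set t0 t.
Proof. by move=> _ tu _; apply: le_trans. Qed.

Definition below (t0 : P) : interval_in P :=
  IntervalIn (below_set_nonempty t0) (@below_set_convex t0).

End NearLeftEnd.

Section TestMorphism.
Context (R : realType) (P : set R) (K : fieldType) (N : persmod P K) (t0 : P).
Variable psi : N t0 -> K.
Hypothesis psi_linear : forall k x y, psi (k *: x + y) = k * psi x + psi y.

(** The default 0 is harmless: the test module vanishes at points not below [t0]. *)
Definition transport (s : P) (x : N s) : N t0 :=
  if pselect (\val s <= \val t0) is left h then pm_map h x else 0.

Lemma transportE s (h : \val s <= \val t0) x : transport x = pm_map h x.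
Proof.
by rewrite /transport; case: pselect => // h'; rewrite (bool_irrelevance h' h).
Qed.

(** As the support of the target is a down-set, a functional on [N t0] extends to a morphism on all
    of [N]. *)
Definition test_fun s (x : N s) : interval_module K (below t0) s :=
  psi (transport x) *: itv_unit K (below t0) s.

Lemma test_fun_linear s : linear (@test_fun s).
Proof.
move=> k x y; rewrite /test_fun.
have [h|nh] := pselect (below_set t0 s).
  by rewrite !transportE linearP psi_linear scalerDl scalerA.
by rewrite [LHS](itv_module_out (I := below t0) _ nh)
  [RHS](itv_module_out (I := below t0) _ nh).
Qed.

HB.instance Definition _ s :=
  GRing.isLinear.Build K (N s) (interval_module K (below t0) s) _
    (@test_fun s) (@test_fun_linear s).

Lemma test_fun_natural s t (h : \val s <= \val t) (x : N s) :
  test_fun (pm_map h x) = pm_map h (test_fun x).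
Proof.
have [h0|nh] := pselect (below_set t0 t).
  have h1 : \val s <= \val t0 by apply: le_trans h h0.
  rewrite /test_fun linearZ /= itv_unit_map // transportE (transportE h1).
  by rewrite -(pm_comp h h0 h1).
by rewrite [LHS](itv_module_out (I := below t0) _ nh)
  [RHS](itv_module_out (I := below t0) _ nh).
Qed.

Definition test_hom : pmhom N (interval_module K (below t0)) :=
  PMHom (hom_fun := fun s => (@test_fun s : {linear _ -> _})) test_fun_natural.

End TestMorphism.

(** The morphisms induced by [psi] and by the zero functional agree after [f], hence agree; at [t]
    this is the claim. *)
Lemma epi_functional (R : realType) (P : set R) (K : fieldType)
    (M N : persmod P K) (f : pmhom M N) (t : P) (psi : N t -> K) :
  epimorphism f ->
  (forall k x y, psi (k *: x + y) = k * psi x + psi y) ->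
  (forall x, psi (f t x) = 0) -> forall y, psi y = 0.
Proof.
move=> fepi psi_lin psi0 y.
have zero_lin k (u v : N t) : (0 : K) = k * 0 + 0 by rewrite mulr0 addr0.
have /fepi/(_ t y) : hom_eq (hom_comp (test_hom psi_lin) f)
    (hom_comp (test_hom zero_lin) f).
  move=> s x; rewrite /= /test_fun.
  have [h|nh] := pselect (below_set t s).
    by rewrite transportE -hom_natural psi0.
  by rewrite [LHS](itv_module_out (I := below t) _ nh)
     [RHS](itv_module_out (I := below t) _ nh).
rewrite /= /test_fun transportE pm_id scale0r.
move/(congr1 (itv_coord K (below t) t)); rewrite linear0 linearZ /=.
rewrite itv_coord_unit; last exact: (lexx (\val t)).
by rewrite [_ *: _]mulr1.
Qed.

(** * The matrix of a morphism between common left ends *)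

Section Coefficients.
Context (R : realType) (P : set R) (K : fieldType) (M N : persmod P K).
Context (f : pmhom M N) (m n : nat).
Context (BM : interval_basis M m) (BN : interval_basis N n).

Definition coef (j : 'I_n) (i : 'I_m) (s : P) : K :=
  coord BN j (f s (gen BM i s)).

(** If the source generator is alive at the earlier point, naturality transports the coefficient.
    Otherwise it has already ended there, the left ends being equal, and both coefficients
    vanish. *)
Lemma coef_const j i s t : upset (itv BN j) = upset (itv BM i) ->
  itv_set (itv BN j) s -> itv_set (itv BN j) t -> coef j i s = coef j i t.
Proof.
move=> e.
wlog st : s t / \val s <= \val t.
  move=> wl Js Jt; have [st|/ltW ts] := leP (\val s) (\val t); first exact: wl.
  by symmetry; apply: wl.
move=> Js Jt; rewrite /coef.
have [Is|nIs] := pselect (itv_set (itv BM i) s).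
  by rewrite -(gen_map st Is) hom_natural coord_map.
rewrite !gen_out ?linear0 ?coord0 // => It; apply: nIs.
by apply: upset_interval It st _; rewrite -e; exact: sub_upset.
Qed.

(** Generator [i] is alive before [itv BN j] starts, so its image at [t] comes from a point where
    generator [j] is not yet present. *)
Lemma coef_out j i s t : itv_set (itv BM i) s -> ~ upset (itv BN j) s ->
  itv_set (itv BN j) t -> coef j i t = 0.
Proof.
move=> Is nJs Jt.
have st : \val s <= \val t.
  by case: (leP (\val s) (\val t)) => // /ltW ts; case: nJs; exists t.
rewrite /coef -(gen_map st Is) hom_natural coord_map_out //.
by move=> Js; apply: nJs; exact: sub_upset.
Qed.

Definition itv_point (I : interval_in P) : P := sval (cid (itv_nonempty I)).

Lemma itv_pointP I : itv_set I (itv_point I).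
Proof. exact: svalP (cid (itv_nonempty I)). Qed.

(** One matrix for all left ends at once; entries between different left ends are set to 0, whatever
    [f] does there. By [coef_const] the sample point is immaterial. *)
Definition left_end_matrix : 'M[K]_(n, m) := \matrix_(j, i)
  if `[< upset (itv BN j) = upset (itv BM i) >]
  then coef j i (itv_point (itv BN j)) else 0.

Lemma left_end_matrix_supp j i : left_end_matrix j i != 0 ->
  upset (itv BN j) = upset (itv BM i).
Proof. by rewrite mxE; case: asboolP => //; rewrite eqxx. Qed.

Lemma left_end_matrixE j i s : upset (itv BN j) = upset (itv BM i) ->
  itv_set (itv BN j) s -> coef j i s = left_end_matrix j i.
Proof.
move=> e Js; rewrite mxE asboolT //; apply: coef_const => //; exact: itv_pointP.
Qed.

(** A relation [u] among the rows, restricted to the left end of [j0], gives a functional near that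
    end which kills the image of [f]. It is therefore zero, and its value on generator [j0] is
    [u 0 j0]. *)
Lemma left_end_matrix_free : epimorphism f -> row_free left_end_matrix.
Proof.
move=> fepi; rewrite -kermx_eq0; apply/rowV0P => u /sub_kermxP uG.
apply/rowP => j0; rewrite [RHS]mxE.
set L := upset (itv BN j0).
(* At the point sought, each generator of [M] starts at [L], is dead, or is alive somewhere outside
   [L], and every generator of [N] starting at [L] is alive. *)
pose C (k : 'I_m + 'I_n) (t : P) := match k with
  | inl i => [\/ upset (itv BM i) = L, ~ itv_set (itv BM i) t |
                 exists2 s, itv_set (itv BM i) s & ~ L s]
  | inr j => upset (itv BN j) = L -> itv_set (itv BN j) t end.
have L0 : L !=set0.
  by exists (itv_point (itv BN j0)); apply: sub_upset; exact: itv_pointP.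
have [[i|j]|t Lt Ct] := @near_left_end _ _ L _ C L0.
(* An up-closure that misses a point [p] of [L] contains nothing below [p]; one that exceeds [L]
   comes from an interval with a point outside [L]. *)
- have [LI|/existsNP[p /not_implyP[Lp nIp]]] := pselect (L `<=` upset (itv BM i)).
    have [IL|/existsNP[p /not_implyP[[s Is sp] nLp]]] :=
        pselect (upset (itv BM i) `<=` L).
      by have [p Lp] := L0; exists p => // t _ _; apply: Or31; apply/seteqP.
    have [q Lq] := L0; exists q => // t _ _; apply: Or33; exists s => //.
    by move=> Ls; apply: nLp; apply: upset_le Ls sp.
  exists p => // t _ tp; apply: Or32 => It; apply: nIp.
  by exists t.
- have [e|ne] := pselect (upset (itv BN j) = L); last first.
    by have [p Lp] := L0; exists p => // t _ _.
  exists (itv_point (itv BN j)) => [|t Lt tp _].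
    by rewrite -e; apply: sub_upset; exact: itv_pointP.
  by apply: upset_interval (itv_pointP _) tp _; rewrite e.
pose psi (y : N t) :=
  \sum_(j | `[< upset (itv BN j) = L >]) u 0 j * coord BN j y.
have Jt j : upset (itv BN j) = L -> itv_set (itv BN j) t := Ct (inr j).
have psi_lin k x y : psi (k *: x + y) = k * psi x + psi y.
  rewrite mulr_sumr -big_split; apply: eq_bigr => j _ /=.
  by rewrite coord_linear mulrDr mulrCA.
have psi_0 : psi 0 = 0 by apply: big1 => j _; rewrite coord0 mulr0.
have psi_gen i : psi (f t (gen BM i t)) = 0.
  case: (Ct (inl i)) => [e|nIt|[s Is nLs]].
  - have /rowP/(_ i) := uG; rewrite !mxE => <-.
    rewrite /psi big_mkcond; apply: eq_bigr => j _.
    case: asboolP => [ej|nej].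
      by rewrite -(left_end_matrixE (s := t)) ?ej ?e //; apply: Jt.
    have [->|/left_end_matrix_supp] := eqVneq (left_end_matrix j i) 0.
      by rewrite mulr0.
    by rewrite e.
  - by rewrite gen_out // linear0.
  - apply: big1 => j /asboolP ej.
    by rewrite [coord _ _ _](coef_out Is) ?mulr0 ?ej //; exact: Jt.
have psi0 x : psi (f t x) = 0.
  rewrite (coord_sum BM x) linear_sum.
  elim/big_rec: _ => [|i y _ yP]; first exact: psi_0.
  by rewrite linearZ psi_lin psi_gen mulr0 add0r.
have := epi_functional fepi psi_lin psi0 (gen BN j0 t).
rewrite /psi (bigD1 j0) /=; last exact/asboolP.
rewrite coord_gen ?eqxx ?mulr1; last exact: Jt.
rewrite big1 ?addr0 // => j /andP[/asboolP ej jj0].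
by rewrite coord_gen ?(negbTE jj0) ?mulr0 //; exact: Jt.
Qed.

End Coefficients.


(** * Direct sums of blocks of generators *)

Section Blocks.
Context (R : realType) (P : set R) (K : fieldType) (M : persmod P K) (n : nat).
Context (B : interval_basis M n) (T : finType) (tau : 'I_n -> T).
Implicit Types (s t : P) (a : T).

(** Generators are grouped by the label [tau]. The identity is used for [M]; for [N] a matching
    [sigma] reindexes the summands by those of [M], and labels outside its image give zero
    blocks. *)
Definition block_proj a s (x : M s) : M s :=
  \sum_(i | tau i == a) coord B i x *: gen B i s.

Lemma block_proj_linear a s : linear (@block_proj a s).
Proof.
move=> k x y; rewrite scaler_sumr -big_split; apply: eq_bigr => i _ /=.
by rewrite coord_linear scalerDl scalerA.
Qed.

HB.instance Definition _ a s := GRing.isLinear.Build K (M s) (M s) _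
  (@block_proj a s) (@block_proj_linear a s).

Lemma block_proj_map a s t (h : \val s <= \val t) (x : M s) :
  block_proj a (pm_map h x) = pm_map h (block_proj a x).
Proof.
rewrite linear_sum; apply: eq_bigr => i _; rewrite linearZ /=.
have [It|nIt] := pselect (itv_set (itv B i) t).
  have [Is|nIs] := pselect (itv_set (itv B i) s).
    by rewrite coord_map // gen_map.
  by rewrite coord_map_out // gen_map_out // scale0r scaler0.
rewrite gen_out // scaler0.
have [Is|nIs] := pselect (itv_set (itv B i) s).
  by rewrite gen_map // gen_out // scaler0.
by rewrite gen_map_out // scaler0.
Qed.

Lemma coord_block a i s (x : M s) :
  coord B i (block_proj a x) *: gen B i s =
  if tau i == a then coord B i x *: gen B i s else 0.
Proof.
have [Is|nIs] := pselect (itv_set (itv B i) s); last first.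
  by rewrite gen_out // !scaler0; case: ifP.
rewrite coord_bigsum; case: eqP => [e|ne].
  rewrite (bigD1 i) ?e //= coordZ coord_gen // eqxx mulr1 big1 ?addr0 //.
  by move=> j /andP[_ ji]; rewrite coordZ coord_gen // eq_sym (negbTE ji) mulr0.
rewrite big1 ?scale0r // => j /eqP e.
rewrite coordZ coord_gen //; case: eqP => [ij|_]; last by rewrite mulr0.
by case: ne; rewrite ij.
Qed.

Lemma block_projK a b s (x : M s) :
  block_proj a (block_proj b x) = if a == b then block_proj b x else 0.
Proof.
rewrite {1}/block_proj; under eq_bigr => i _ do rewrite coord_block.
case: eqP => [->|ne]; first by apply: eq_bigr => i ->.
by apply: big1 => i /eqP ->; case: eqP.
Qed.

Lemma block_proj_sum s (x : M s) : \sum_a block_proj a x = x.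
Proof. by rewrite [RHS](coord_sum B x) (partition_big tau xpredT). Qed.

(** The image of an idempotent, written as its fixed points so that membership is a boolean
    equation. *)
Definition block_pred a s : {pred M s} := [pred x | block_proj a x == x].

Lemma block_closed a s : submod_closed (@block_pred a s).
Proof.
split=> [|k x y]; rewrite !inE ?linear0 // => /eqP ex /eqP ey.
by rewrite linearP /= ex ey.
Qed.

Lemma block_map a s t (h : \val s <= \val t) (x : M s) :
  x \in ss_pred (Subspace (block_closed a s)) ->
  pm_map h x \in ss_pred (Subspace (block_closed a t)).
Proof. by rewrite !inE block_proj_map => /eqP ->. Qed.

Definition block a : submodule M := Submodule (@block_map a).

Lemma block_val a s (x : block a s) : block_proj a (incl_fun x) = incl_fun x.
Proof. by apply/eqP; exact: (valP x). Qed.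

Lemma block_proj_in a s (x : M s) :
  block_proj a x \in ss_pred (sub_space (block a) s).
Proof. by rewrite inE block_projK eqxx. Qed.

Definition to_block a s (x : M s) : block a s :=
  exist _ (block_proj a x) (block_proj_in a x).

Lemma block_direct_sum : internal_direct_sum block.
Proof.
move=> s x; exists (fun a => to_block a x); split.
  by rewrite -[LHS](block_proj_sum x).
move=> y ->; apply: functional_extensionality_dep => a; apply: val_inj => /=.
rewrite linear_sum (bigD1 a) //= big1 ?addr0 => [|b ba].
  by rewrite block_val.
by rewrite -block_val block_projK eq_sym (negbTE ba).
Qed.

Lemma dsum_proj_block (D : internal_direct_sum block) a s (x : M s) :
  incl_fun (dsum_proj D a s x) = block_proj a x.
Proof.
rewrite /= /proj_fun.
suff -> : decomp D x = fun a => to_block a x by [].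
by apply: decomp_uniq; rewrite -[LHS](block_proj_sum x).
Qed.

Hypothesis tau_inj : injective tau.

Lemma block_proj_inj i s (x : M s) :
  block_proj (tau i) x = coord B i x *: gen B i s.
Proof.
by rewrite /block_proj (eq_bigl (pred1 i)) ?big_pred1_eq // => j; exact: inj_eq.
Qed.

Lemma block_zero a : (forall i, tau i != a) -> zero_module (block a).
Proof.
move=> h s x; apply: val_inj; rewrite /= -[LHS]block_val.
by apply: big_pred0 => i; apply/negbTE.
Qed.

(** An injective [tau] leaves one generator in the block; exchanging it with the unit of the
    interval module gives both maps. *)
Lemma block_interval i : isomorphic (block (tau i)) (interval_module K (itv B i)).
Proof.
pose F s (x : block (tau i) s) : interval_module K (itv B i) s :=
  coord B i (incl_fun x) *: itv_unit K (itv B i) s.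
have F_lin s : linear (F s).
  by move=> k x y; rewrite /F linearP coord_linear scalerDl scalerA.
pose G s (x : interval_module K (itv B i) s) : block (tau i) s :=
  to_block (tau i) (itv_coord K (itv B i) s x *: gen B i s).
have G_lin s : linear (G s).
  by move=> k x y; apply: val_inj; rewrite /= linearP scalerDl -scalerA linearP.
pose FL s : {linear block (tau i) s -> interval_module K (itv B i) s} :=
  HB.pack (F s) (GRing.isLinear.Build K _ _ _ (F s) (F_lin s)).
pose GL s : {linear interval_module K (itv B i) s -> block (tau i) s} :=
  HB.pack (G s) (GRing.isLinear.Build K _ _ _ (G s) (G_lin s)).
have FK s x : GL s (FL s x) = x.
  apply: val_inj; rewrite /= block_proj_inj linearZ /=.
  rewrite -[RHS]block_val block_proj_inj.
  have [Is|nIs] := pselect (itv_set (itv B i) s); last first.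
    by rewrite gen_out // !scaler0.
  by rewrite coordZ coord_gen // eqxx itv_coord_unit // mulr1 [_%:A]mulr1.
have GK s x : FL s (GL s x) = x.
  have [Is|nIs] := pselect (itv_set (itv B i) s); last first.
    by rewrite [LHS](itv_module_out _ nIs) [RHS](itv_module_out _ nIs).
  rewrite /= /F /= /incl_fun /= block_proj_inj !coordZ coord_gen // eqxx !mulr1.
  exact: itv_coordK.
have F_nat s t (h : \val s <= \val t) x : FL t (pm_map h x) = pm_map h (FL s x).
  have [It|nIt] := pselect (itv_set (itv B i) t); last first.
    by rewrite [LHS](itv_module_out _ nIt) [RHS](itv_module_out _ nIt).
  have [Is|nIs] := pselect (itv_set (itv B i) s).
    by rewrite linearZ itv_unit_map //= /F incl_natural coord_map.
  rewrite [FL s x](itv_module_out _ nIs) linear0 /= /F incl_natural.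
  by rewrite coord_map_out // scale0r.
have G_nat s t (h : \val s <= \val t) x : GL t (pm_map h x) = pm_map h (GL s x).
  by rewrite -[in LHS](GK s x) -F_nat FK.
by exists (PMHom F_nat), (PMHom G_nat).
Qed.

End Blocks.


(** * Independence of the chosen interval *)

Section Invariance.
Context (R : realType) (P : set R) (K : fieldType) (M : persmod P K).
Implicit Types (I J : interval_in P).

Lemma isomorphic_itv_sub I J : isomorphic M (interval_module K I) ->
  isomorphic M (interval_module K J) -> itv_set I `<=` itv_set J.
Proof.
move=> [f [g [fK gK]]] [f' [g' [f'K g'K]]] s Is; apply: contrapT => nJs.
have : g s (itv_unit K I s) = 0.
  rewrite -[LHS]f'K [f' s _](itv_module_out _ nJs); exact: linear0.
move/(congr1 (f s)); rewrite gK linear0 => /(congr1 (itv_coord K I s)).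
by rewrite itv_coord_unit // linear0 => /eqP; rewrite oner_eq0.
Qed.

(** Intervals provided by [same_left_end_mod] can thus be compared with those of the bases. *)
Lemma isomorphic_upset I J : isomorphic M (interval_module K I) ->
  isomorphic M (interval_module K J) -> upset I = upset J.
Proof.
move=> MI MJ; have e : itv_set I = itv_set J.
  by apply/seteqP; split; apply: isomorphic_itv_sub.
by rewrite /upset e.
Qed.

Lemma interval_nonzero I : isomorphic M (interval_module K I) -> ~ zero_module M.
Proof.
move=> [f [g [fK gK]]] M0; have [s Is] := itv_nonempty I.
have := itv_coord_unit K Is.
by rewrite -(gK s (itv_unit K I s)) (M0 s (g s _)) !linear0 => /esym/eqP;
  rewrite oner_eq0.
Qed.

End Invariance.

(** * Matched bases and the components of the epimorphism *)

Lemma surjective_epimorphism (R : realType) (P : set R) (K : fieldType)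
    (M N : persmod P K) (f : pmhom M N) :
  (forall s y, exists x, f s x = y) -> epimorphism f.
Proof. by move=> fsurj Q g h gh s y; have [x <-] := fsurj s y; exact: gh. Qed.

Section NormalBases.
Context (R : realType) (P : set R) (K : fieldType) (M N : persmod P K).
Context (f : pmhom M N) (m n : nat).

(** The last clause describes the rows of the reduced matrix; together with injectivity of [sigma]
    it also leaves one nonzero entry in each matched column. *)
Definition matched (BM : interval_basis M m) (BN : interval_basis N n)
    (sigma : 'I_n -> 'I_m) :=
  [/\ injective sigma,
      forall j, upset (itv BN j) = upset (itv BM (sigma j)) &
      forall j i t, upset (itv BN j) = upset (itv BM i) ->
        itv_set (itv BN j) t -> (coef f BM BN j i t != 0) = (i == sigma j)].

Lemma matched_bases (BM : interval_basis M m) (BN : interval_basis N n) :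
  epimorphism f -> exists (BM' : interval_basis M m)
    (BN' : interval_basis N n) (sigma : 'I_n -> 'I_m), matched BM' BN' sigma.
Proof.
move=> fepi.
set G := left_end_matrix f BM BN.
have [Q [Q' [S [S' [sigma [incQ incS red]]]]]] :=
  matrix_normal_form (incl_rel_refl (itv BM)) (@incl_rel_trans _ _ _ (itv BM))
    (incl_rel_refl (itv BN)) (@incl_rel_trans _ _ _ (itv BN))
    (@incl_rel_total _ _ _ (itv BM)) (@incl_rel_total _ _ _ (itv BN))
    (@left_end_matrix_supp _ _ _ _ _ f _ _ BM BN) (left_end_matrix_free BM BN fepi).
have [BM' [itvM genM _]] := basis_change incS.
(* The generators of [N] are changed by [Q'], so its coordinates are multiplied by [Q] and the new
   matrix is [Q *m G *m S]. *)
have [BN' [itvN _ coordN]] := basis_change (incidence_sym incQ).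
have [_ sQ _] := incQ; have [_ sS _] := incS.
have supp j i : (Q *m G *m S) j i != 0 -> upset (itv BN j) = upset (itv BM i).
  rewrite mxE => /sum_neq0[l]; rewrite mulf_eq0 negb_or => /andP[+ /sS/asboolP[<- _]].
  rewrite mxE => /sum_neq0[k]; rewrite mulf_eq0 negb_or => /andP[/sQ/asboolP[-> _]].
  exact: left_end_matrix_supp.
exists BM', BN', sigma; split.
- move=> j k e; have [r1 _] := red j; have [_ r2] := red k.
  by apply/eqP; rewrite -r2 -e r1.
- move=> j; rewrite itvM itvN; apply: supp.
  by have [-> _] := red j.
move=> j i t; rewrite itvM itvN => e Jt; have [<- _] := red j.
congr (_ != 0); rewrite /coef coordN genM linear_sum mxE.
under [RHS]eq_bigr => l _ do rewrite mxE mulr_suml.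
rewrite exchange_big /=; apply: eq_bigr => k _.
rewrite coord_bigsum mulr_sumr; apply: eq_bigr => l _.
rewrite linearZ coordZ mulrCA mulrC.
have [->|/sQ/asboolP[ek sub]] := eqVneq (Q j k) 0; first by rewrite !mul0r.
have [->|/sS/asboolP[el _]] := eqVneq (S l i) 0; first by rewrite !mulr0.
by rewrite -(@left_end_matrixE _ _ _ _ _ f _ _ BM BN k l t) // -?ek ?el //; exact: sub.
Qed.

Context (BM : interval_basis M m) (BN : interval_basis N n).
Context (sigma : 'I_n -> 'I_m) (mtch : matched BM BN sigma).
Let Ma := block BM id.
Let Na := block BN sigma.
Context (DN : internal_direct_sum Na).

(** Both blocks are spanned by a single generator, so the component of [f] between them is one
    scalar at each point. *)
Lemma matched_component j i s (x : Ma i s) :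
  incl_fun (dsum_proj DN (sigma j) s (f s (sub_incl (Ma i) s x))) =
  (coord BM i (incl_fun x) * coef f BM BN j i s) *: gen BN j s.
Proof.
have [sigma_inj _ _] := mtch.
rewrite dsum_proj_block block_proj_inj // /= -{1}[incl_fun x]block_val.
by rewrite (block_proj_inj _ (@inj_id _)) linearZ coordZ.
Qed.

Lemma matched_zero j i : i <> sigma j ->
  upset (itv BN j) = upset (itv BM i) ->
  hom_zero (hom_comp (dsum_proj DN (sigma j)) (hom_comp f (sub_incl (Ma i)))).
Proof.
move=> /eqP ij e s x; apply: val_inj; apply: etrans (matched_component _ _) _.
have [_ _ red] := mtch.
have [Js|nJs] := pselect (itv_set (itv BN j) s); last by rewrite gen_out ?scaler0.
have /eqP -> : coef f BM BN j i s == 0 by rewrite -[_ == _]negbK red.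
by rewrite mulr0 scale0r.
Qed.

(** Surjectivity holds pointwise: on [itv BN j] a preimage is found by dividing by the nonzero
    coefficient, elsewhere the target is zero. *)
Lemma matched_epi j : epimorphism
  (hom_comp (dsum_proj DN (sigma j)) (hom_comp f (sub_incl (Ma (sigma j))))).
Proof.
have [sigma_inj up red] := mtch.
apply: surjective_epimorphism => s y.
have yE : incl_fun y = coord BN j (incl_fun y) *: gen BN j s.
  by rewrite -{1}block_val block_proj_inj.
have [Js|nJs] := pselect (itv_set (itv BN j) s); last first.
  exists 0; rewrite linear0; apply: val_inj.
  by apply/esym/(etrans yE); rewrite gen_out // scaler0.
have c0 : coef f BM BN j (sigma j) s != 0 by rewrite red.
(* A nonzero coefficient forces the source generator to be alive. *)
have Is : itv_set (itv BM (sigma j)) s.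
  apply: contrapT => nIs; move/eqP: c0; apply.
  by rewrite /coef gen_out // linear0 coord0.
exists (to_block BM id (sigma j)
  (coord BN j (incl_fun y) / coef f BM BN j (sigma j) s *: gen BM (sigma j) s)).
apply: val_inj; apply: etrans (matched_component _ _) _; rewrite [RHS]yE.
rewrite /incl_fun /= (block_proj_inj _ (@inj_id _)) !coordZ coord_gen // eqxx !mulr1.
by rewrite divfK.
Qed.

End NormalBases.

(** * Assembly of the two decompositions *)

Theorem theorem1p7 (R : realType) (P : set R) (K : fieldType)
    (M N : persmod P K) (f : pmhom M N)
    (Mdec : finitely_interval_decomposable M)
    (Ndec : finitely_interval_decomposable N)
    (fepi : epimorphism f) :
  exists (A : finType) (Ma : A -> submodule M) (Na : A -> submodule N)
    (DM : internal_direct_sum Ma) (DN : internal_direct_sum Na),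
    (forall a : A, is_interval_module (Ma a)) /\
    (forall a : A, is_interval_module (Na a) \/ zero_module (Na a)) /\
    (forall a : A, ~ zero_module (Na a) ->
      same_left_end_mod (Ma a) (Na a) /\
      epimorphism (hom_comp (dsum_proj DN a) (hom_comp f (sub_incl (Ma a)))) /\
      (forall b : A, b <> a -> same_left_end_mod (Ma b) (Na a) ->
        hom_zero (hom_comp (dsum_proj DN a) (hom_comp f (sub_incl (Ma b))))) /\
      (forall b : A, b <> a -> same_left_end_mod (Na b) (Ma a) ->
        hom_zero (hom_comp (dsum_proj DN b) (hom_comp f (sub_incl (Ma a)))))).
Proof.
have [m [BM0]] := decomposition_basis Mdec.
have [n [BN0]] := decomposition_basis Ndec.
have [BM [BN [sigma mtch]]] := matched_bases BM0 BN0 fepi.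
have [sigma_inj up _] := mtch.
have Miso i : isomorphic (block BM id i) (interval_module K (itv BM i)).
  exact: (block_interval BM (@inj_id _)).
have Niso j : isomorphic (block BN sigma (sigma j)) (interval_module K (itv BN j)).
  exact: (block_interval BN sigma_inj).
have Ncases i : zero_module (block BN sigma i) \/ exists j, i = sigma j.
  have [[j ->]|h] := pselect (exists j, i = sigma j); first by right; exists j.
  by left; apply: block_zero => j; apply/eqP => e; apply: h; exists j.
(* Both families are indexed by the generators of [M]; indices outside the image of [sigma] receive
   a zero summand of [N]. *)
exists 'I_m, (block BM id), (block BN sigma).
exists (block_direct_sum BM id), (block_direct_sum BN sigma).
split; first by move=> i; exists (itv BM i).
split.
  move=> i; have [h|[j ->]] := Ncases i; first by right.
  by left; exists (itv BN j).
move=> a a0; have [/a0 []|[j aj]] := Ncases a; move: a0; rewrite aj => _.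
split.
  exists (itv BM (sigma j)), (itv BN j); split; [exact: Miso|exact: Niso|].
  by apply: upset_same_left_end; rewrite up.
split; first exact: matched_epi.
split=> b ba [I [J [bI aJ /same_left_end_upset IJ]]].
  apply: matched_zero => //.
  by rewrite (isomorphic_upset (Niso j) aJ) -IJ; apply: isomorphic_upset bI _.
(* The summand of [N] at [b] is an interval module, hence nonzero, so [b] is some [sigma k]. *)
have [/(interval_nonzero bI) []|[k bk]] := Ncases b.
move: ba bI; rewrite bk => ba bI; apply: matched_zero => //.
  by move=> e; apply: ba.
by rewrite (isomorphic_upset (Niso k) bI) IJ; apply: isomorphic_upset aJ _.
Qed.
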